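(* Let $B_k\in\mathbb{R}^{(n+m)\times(n+m)}$ be a $J$-symmetric matrix, and let $s_k,y_k\in\mathbb{R}^{n+m}$ with $s_k\neq 0$. Consider the constrained optimization problem $$\min_{B}\ \tfrac12\|B-B_k\|_F^2\quad\text{s.t.}\quad Bs_k-y_k=0,\qquad B=\begin{bmatrix} D & A^T\\ -A & C\end{bmatrix},\quad D=D^T,\ C=C^T,$$ where $D\in\mathbb{R}^{n\times n}$, $C\in\mathbb{R}^{m\times m}$, $A\in\mathbb{R}^{m\times n}$. Its unique solution is $$B_{k+1}=B_k+\frac{Js_k(y_k-B_ks_k)^TJ}{s_k^Ts_k}+\frac{(y_k-B_ks_k)s_k^T}{s_k^Ts_k}-\frac{(Js_k)^T(y_k-B_ks_k)\,Js_ks_k^T}{(s_k^Ts_k)^2},$$ and this is a rank-2 update of $B_k$ (that is, $B_{k+1}-B_k$ is a sum of two rank-one (or zero) matrices, so has rank at most $2$).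
   Context: $J=\begin{bmatrix} I_{n\times n}&0\\0&-I_{m\times m}\end{bmatrix}\in\mathbb{R}^{(n+m)\times(n+m)}$. A matrix $M\in\mathbb{R}^{(n+m)\times(n+m)}$ is called $J$-symmetric if $M=JM^TJ$; equivalently, $M=\begin{bmatrix} D & A^T\\ -A & C\end{bmatrix}$ with $D\in\mathbb{R}^{n\times n}$ and $C\in\mathbb{R}^{m\times m}$ symmetric and $A\in\mathbb{R}^{m\times n}$. $\|\cdot\|_F$ is the Frobenius norm. *)

(* Defs.v *)
From mathcomp Require Export all_boot all_order all_algebra.
From mathcomp Require Export reals.

Set Implicit Arguments.
Unset Strict Implicit.
Unset Printing Implicit Defensive.

Import GRing.Theory Num.Theory.
Local Open Scope ring_scope.

Definition Jmx (R : realType) (n m : nat) : 'M[R]_(n + m) :=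
  block_mx 1%:M 0 0 (- 1%:M).

Definition J_symmetric (R : realType) (n m : nat) (M : 'M[R]_(n + m)) : Prop :=
  M = Jmx R n m *m M^T *m Jmx R n m.

Definition frobenius_norm (R : realType) (p q : nat) (M : 'M[R]_(p, q)) : R :=
  Num.sqrt (\sum_(i < p) \sum_(j < q) M i j ^+ 2).

(* u^T v as a scalar rather than as a 1 x 1 matrix *)
Definition dot (R : realType) (p : nat) (u v : 'cV[R]_p) : R :=
  (u^T *m v) 0 0.

Definition is_minimizer (R : realType) (T : Type)
    (feasible : T -> Prop) (objective : T -> R) (x : T) : Prop :=
  feasible x /\ forall z : T, feasible z -> objective x <= objective z.

Definition update_objective (R : realType) (n m : nat)
    (Bk B : 'M[R]_(n + m)) : R :=
  2%:R^-1 * frobenius_norm (B - Bk) ^+ 2.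

Definition update_feasible (R : realType) (n m : nat)
    (s y : 'cV[R]_(n + m)) (B : 'M[R]_(n + m)) : Prop :=
  B *m s - y = 0 /\
  exists (D : 'M[R]_n) (C : 'M[R]_m) (A : 'M[R]_(m, n)),
    [/\ B = block_mx D A^T (- A) C, D = D^T & C = C^T].

Definition J_update (R : realType) (n m : nat)
    (Bk : 'M[R]_(n + m)) (s y : 'cV[R]_(n + m)) : 'M[R]_(n + m) :=
  let J := Jmx R n m in
  let r := y - Bk *m s in
  Bk + (dot s s)^-1 *: (J *m s *m r^T *m J)
     + (dot s s)^-1 *: (r *m s^T)
     - (dot (J *m s) r / dot s s ^+ 2) *: (J *m s *m s^T).

Definition is_sum_of_two_rank_le1 (R : realType) (p q : nat)
    (M : 'M[R]_(p, q)) : Prop :=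
  exists M1 M2 : 'M[R]_(p, q),
    [/\ M = M1 + M2, (\rank M1 <= 1)%N & (\rank M2 <= 1)%N].

(* Main.v *)
Require Import Defs.
Import GRing.Theory Num.Theory Order.TTheory.

Set Implicit Arguments.
Unset Strict Implicit.
Unset Printing Implicit Defensive.

Local Open Scope ring_scope.

(** Write [E = B - Bk] and [r = yk - Bk *m sk].  Because [Bk] is J-symmetric,
    the feasible set is the affine space of all [Bk + E] with [E] J-symmetric
    and [E *m sk = r], and the objective is half of the squared Frobenius norm
    of [E]; so the optimal [E] is the orthogonal projection of 0 onto the affine
    space [{E J-symmetric, E *m sk = r}].  The substitution [S = J E] turns
    J-symmetric matrices into symmetric ones and preserves the norm: the formula
    is the Powell symmetric Broyden update in disguise.

    A correction [E0] is this projection as soon as it belongs to the affine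
    space and is orthogonal to its direction, which consists of the J-symmetric
    [H] with [H *m sk = 0].  Membership is a computation
    ([J_correction_secant], [J_symmetric_J_correction]).  Orthogonality
    ([J_correction_orthogonal]) holds because each of the three terms of the
    update has [sk^T] as its right factor or [J *m sk] as its left factor.  The
    inner product of [H] with the former contains [H *m sk], and with the latter
    [sk^T *m J *m H], which J-symmetry turns into [(H *m sk)^T *m J]; both
    vanish.  The Pythagorean identity [|E0 + H|^2 = |E0|^2 + |H|^2] then gives
    optimality and uniqueness at once ([update_objective_pythagoras]).

    For the rank, the two terms with left factor [J *m sk] merge into a single
    outer product, and the remaining term is another one
    ([J_correction_two_rank_le1]). *)

(** * The Frobenius inner product *)

Lemma frobenius_normE (R : realType) (p q : nat) (M : 'M[R]_(p, q)) :
  frobenius_norm M ^+ 2 = \tr (M^T *m M).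
Proof.
rewrite /frobenius_norm sqr_sqrtr; last first.
  by apply: sumr_ge0 => i _; apply: sumr_ge0 => j _; exact: sqr_ge0.
rewrite exchange_big /=; apply: eq_bigr => j _.
by rewrite mxE; apply: eq_bigr => i _; rewrite mxE expr2.
Qed.

Lemma frobenius_norm_eq0 (R : realType) (p q : nat) (M : 'M[R]_(p, q)) :
  frobenius_norm M ^+ 2 = 0 -> M = 0.
Proof.
rewrite frobenius_normE => M0; apply/matrixP => i j; rewrite mxE.
have nneg k l : 0 <= M^T k l * M l k by rewrite mxE -expr2 sqr_ge0.
have row0 : (M^T *m M) j j = 0.
  apply: (psumr_eq0P _ M0) => // k _.
  by rewrite mxE; apply: sumr_ge0.
rewrite mxE in row0.
have entry0 : M^T j i * M i j = 0 by apply: (psumr_eq0P _ row0).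
by move/eqP: entry0; rewrite mxE mulf_eq0 orbb => /eqP.
Qed.

Lemma frobenius_pythagoras (R : realType) (p q : nat) (M N : 'M[R]_(p, q)) :
  \tr (M^T *m N) = 0 ->
  frobenius_norm (M + N) ^+ 2 = frobenius_norm M ^+ 2 + frobenius_norm N ^+ 2.
Proof.
move=> MN0; have NM0 : \tr (N^T *m M) = 0.
  by rewrite -mxtrace_tr trmx_mul trmxK.
rewrite !frobenius_normE [(M + N)^T]linearD /= mulmxDl !mulmxDr !mxtraceD.
by rewrite MN0 NM0 addr0 add0r.
Qed.

Lemma dot_scalar_mx (R : realType) (p : nat) (u v : 'cV[R]_p) :
  u^T *m v = (dot u v)%:M.
Proof. exact: mx11_scalar. Qed.

Lemma dotC (R : realType) (p : nat) (u v : 'cV[R]_p) : dot u v = dot v u.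
Proof. by rewrite /dot -[u^T *m v]trmxK trmx_mul trmxK mxE. Qed.

Lemma dot_self_neq0 (R : realType) (p : nat) (u : 'cV[R]_p) :
  u <> 0 -> dot u u != 0.
Proof.
move=> u0; apply/eqP => uu0; apply: u0; apply: frobenius_norm_eq0.
by rewrite frobenius_normE dot_scalar_mx uu0 mxtrace_scalar.
Qed.

(** * J-symmetric matrices *)

Lemma Jmx_tr (R : realType) (n m : nat) : (Jmx R n m)^T = Jmx R n m.
Proof. by rewrite /Jmx tr_block_mx linearN /= !trmx1 !trmx0. Qed.

Lemma Jmx_invol (R : realType) (n m : nat) : Jmx R n m *m Jmx R n m = 1%:M.
Proof.
rewrite /Jmx mulmx_block !mulmx0 !mul0mx mulmx1 mulmxN mulmx1 opprK.
by rewrite !addr0 add0r -scalar_mx_block.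
Qed.

Lemma J_symmetric_block (R : realType) (n m : nat) (B : 'M[R]_(n + m)) :
  J_symmetric B <->
  exists (D : 'M[R]_n) (C : 'M[R]_m) (A : 'M[R]_(m, n)),
    [/\ B = block_mx D A^T (- A) C, D = D^T & C = C^T].
Proof.
have conj_tr D A' A C : Jmx R n m *m (block_mx D A' A C)^T *m Jmx R n m
    = block_mx D^T (- A^T) (- A'^T) C^T.
  rewrite /Jmx tr_block_mx !mulmx_block !mulmx0 !mul0mx !mulmx1 !mul1mx.
  by rewrite !addr0 !add0r !mulNmx !mul1mx !mulmxN !mulmx1 opprK.
split.
- rewrite /J_symmetric -[B]submxK conj_tr => /eq_block_mx[ulE urE _ drE].
  exists (ulsubmx B), (drsubmx B), (- dlsubmx B).
  by split=> //; rewrite opprK linearN /= -urE.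
- move=> [D [C [A [-> DE CE]]]]; rewrite /J_symmetric conj_tr.
  by rewrite trmxK linearN /= opprK -DE -CE.
Qed.

Lemma J_symmetricD (R : realType) (n m : nat) (M N : 'M[R]_(n + m)) :
  J_symmetric M -> J_symmetric N -> J_symmetric (M + N).
Proof.
by rewrite /J_symmetric => MJ NJ; rewrite linearD /= mulmxDr mulmxDl -MJ -NJ.
Qed.

Lemma J_symmetricB (R : realType) (n m : nat) (M N : 'M[R]_(n + m)) :
  J_symmetric M -> J_symmetric N -> J_symmetric (M - N).
Proof.
rewrite /J_symmetric => MJ NJ.
by rewrite linearB /= mulmxBr mulmxBl -MJ -NJ.
Qed.

(** * The correction of least norm *)

(** The increment [J_update Bk s y - Bk], which depends on [Bk] and [y] only
    through the residual [r]. *)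
Definition J_correction (R : realType) (n m : nat) (s r : 'cV[R]_(n + m)) :
    'M[R]_(n + m) :=
  let J := Jmx R n m in
  (dot s s)^-1 *: (J *m s *m r^T *m J) + (dot s s)^-1 *: (r *m s^T)
    - (dot (J *m s) r / dot s s ^+ 2) *: (J *m s *m s^T).

Lemma J_updateE (R : realType) (n m : nat) (Bk : 'M[R]_(n + m))
    (s y : 'cV[R]_(n + m)) :
  J_update Bk s y = Bk + J_correction s (y - Bk *m s).
Proof. by rewrite /J_update /J_correction !addrA. Qed.

(** The first term produces a spurious multiple of [J *m s] when applied to
    [s]; the third term is there to cancel it. *)
Lemma J_correction_secant (R : realType) (n m : nat) (s r : 'cV[R]_(n + m)) :
  s <> 0 -> J_correction s r *m s = r.
Proof.
move=> /dot_self_neq0 ss0; rewrite /J_correction; set J := Jmx R n m.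
have rJs : r^T *m (J *m s) = (dot (J *m s) r)%:M.
  by rewrite dot_scalar_mx dotC.
rewrite mulmxBl mulmxDl -!scalemxAl -!mulmxA rJs dot_scalar_mx.
rewrite !mul_mx_scalar -!scalemxAr !scalerA mulVf // scale1r.
rewrite expr2 invfM mulrA divfK // [X in X *: _ + _]mulrC.
by rewrite addrAC subrr add0r.
Qed.

(** The involution [M |-> J M^T J] exchanges the first two terms and fixes the
    third. *)
Lemma J_symmetric_J_correction (R : realType) (n m : nat)
    (s r : 'cV[R]_(n + m)) :
  J_symmetric (J_correction s r).
Proof.
rewrite /J_symmetric /J_correction; set J := Jmx R n m.
have JJ : J *m J = 1%:M by exact: Jmx_invol.
have JT : J^T = J by exact: Jmx_tr.
have swap1 : J *m (J *m s *m r^T *m J)^T *m J = r *m s^T.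
  by rewrite !trmx_mul trmxK JT !mulmxA JJ mul1mx -!mulmxA JJ mulmx1.
have swap2 : J *m (r *m s^T)^T *m J = J *m s *m r^T *m J.
  by rewrite trmx_mul trmxK !mulmxA.
have fix3 : J *m (J *m s *m s^T)^T *m J = J *m s *m s^T.
  by rewrite !trmx_mul trmxK JT -!mulmxA JJ mulmx1.
rewrite [(_ - _)^T]linearB /= [(_ + _)^T]linearD /= ![(_ *: _)^T]linearZ /=.
rewrite mulmxBr mulmxDr mulmxBl mulmxDl.
rewrite -!scalemxAr -!scalemxAl swap1 swap2 fix3.
by rewrite [X in _ = X - _]addrC.
Qed.

Lemma J_correction_orthogonal (R : realType) (n m : nat)
    (s r : 'cV[R]_(n + m)) (H : 'M[R]_(n + m)) :
  J_symmetric H -> H *m s = 0 -> \tr ((J_correction s r)^T *m H) = 0.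
Proof.
rewrite /J_symmetric /J_correction; set J := Jmx R n m => HJ Hs0.
have JJ : J *m J = 1%:M by exact: Jmx_invol.
have JT : J^T = J by exact: Jmx_tr.
(* [s] is a right null vector of [H], so [J *m s] is a left one. *)
have sJH : s^T *m J *m H = 0.
  rewrite HJ !mulmxA -(mulmxA s^T) JJ mulmx1.
  by rewrite -(trmx_mul H s) Hs0 trmx0 mul0mx.
have orth1 : (J *m s *m r^T *m J)^T *m H = 0.
  by rewrite !trmx_mul trmxK JT -!mulmxA (mulmxA s^T) sJH !mulmx0.
have orth2 : \tr ((r *m s^T)^T *m H) = 0.
  by rewrite trmx_mul trmxK -mulmxA mxtrace_mulC -mulmxA Hs0 mulmx0 mxtrace0.
have orth3 : (J *m s *m s^T)^T *m H = 0.
  by rewrite !trmx_mul trmxK JT -mulmxA sJH mulmx0.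
rewrite [(_ - _)^T]linearB /= [(_ + _)^T]linearD /= ![(_ *: _)^T]linearZ /=.
rewrite mulmxBl mulmxDl -!scalemxAl orth1 orth3.
by rewrite !scaler0 subr0 add0r mxtraceZ orth2 mulr0.
Qed.

Lemma rank_outer_le1 (R : realType) (p q : nat) (u : 'cV[R]_p) (v : 'rV[R]_q) :
  (\rank (u *m v) <= 1)%N.
Proof. exact: leq_trans (mxrankM_maxr u v) (rank_leq_row v). Qed.

Lemma J_correction_two_rank_le1 (R : realType) (n m : nat)
    (s r : 'cV[R]_(n + m)) :
  is_sum_of_two_rank_le1 (J_correction s r).
Proof.
set J := Jmx R n m.
exists (J *m s *m ((dot s s)^-1 *: (r^T *m J)
                   - (dot (J *m s) r / dot s s ^+ 2) *: s^T)),
       (r *m ((dot s s)^-1 *: s^T)).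
split; [|exact: rank_outer_le1..].
by rewrite mulmxBr -!scalemxAr mulmxA addrAC.
Qed.

Lemma sum_of_two_rank_le1_rank (R : realType) (p q : nat) (M : 'M[R]_(p, q)) :
  is_sum_of_two_rank_le1 M -> (\rank M <= 2)%N.
Proof.
move=> [M1 [M2 [-> rk1 rk2]]].
exact: leq_trans (mxrank_add M1 M2) (leq_add rk1 rk2).
Qed.

(** * The constrained problem *)

Lemma update_feasibleE (R : realType) (n m : nat) (s y : 'cV[R]_(n + m))
    (B : 'M[R]_(n + m)) :
  update_feasible s y B <-> B *m s = y /\ J_symmetric B.
Proof.
split=> -[Bsy /J_symmetric_block BJ]; split=> //.
  by apply/eqP; rewrite -subr_eq0 Bsy.
by rewrite Bsy subrr.
Qed.

Lemma J_update_feasible (R : realType) (n m : nat) (Bk : 'M[R]_(n + m))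
    (s y : 'cV[R]_(n + m)) :
  J_symmetric Bk -> s <> 0 -> update_feasible s y (J_update Bk s y).
Proof.
move=> BkJ s0; apply/update_feasibleE; rewrite J_updateE; split.
  by rewrite mulmxDl J_correction_secant // addrC subrK.
exact: J_symmetricD BkJ (J_symmetric_J_correction _ _).
Qed.

Lemma update_objective_pythagoras (R : realType) (n m : nat)
    (Bk B : 'M[R]_(n + m)) (s y : 'cV[R]_(n + m)) :
  J_symmetric Bk -> s <> 0 -> update_feasible s y B ->
  update_objective Bk B = update_objective Bk (J_update Bk s y)
                          + 2%:R^-1 * frobenius_norm (B - J_update Bk s y) ^+ 2.
Proof.
move=> BkJ s0 /update_feasibleE[Bs BJ].
have /update_feasibleE[B0s B0J] := J_update_feasible y BkJ s0.
rewrite /update_objective -mulrDr -frobenius_pythagoras.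
  by rewrite [in RHS]addrC addrA subrK.
rewrite {1}J_updateE addrAC subrr add0r.
apply: J_correction_orthogonal; first exact: J_symmetricB BJ B0J.
by rewrite mulmxBl Bs B0s subrr.
Qed.

Theorem proposition2p1 (R : realType) (n m : nat)
  (Bk : 'M[R]_(n + m)) (sk yk : 'cV[R]_(n + m))
  (hBk : J_symmetric Bk) (hsk : sk <> 0) :
  unique (is_minimizer (update_feasible sk yk) (update_objective Bk))
         (J_update Bk sk yk)
  /\ is_sum_of_two_rank_le1 (J_update Bk sk yk - Bk)
  /\ (\rank (J_update Bk sk yk - Bk)%R <= 2)%N.
Proof.
have feas := J_update_feasible yk hBk hsk.
have two_rank1 : is_sum_of_two_rank_le1 (J_update Bk sk yk - Bk).
  rewrite J_updateE addrAC subrr add0r.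
  exact: J_correction_two_rank_le1.
have half_gt0 : 0 < 2%:R^-1 :> R by rewrite invr_gt0 ltr0n.
split; last by split=> //; exact: sum_of_two_rank_le1_rank.
split.
  split=> // B /(update_objective_pythagoras hBk hsk) ->.
  by rewrite lerDl mulr_ge0 ?sqr_ge0 // ltW.
move=> B [Bfeas Bmin].
have := Bmin _ feas.
rewrite (update_objective_pythagoras hBk hsk Bfeas) gerDl pmulr_rle0 // => le0.
symmetry; apply/eqP; rewrite -subr_eq0; apply/eqP; apply: frobenius_norm_eq0.
by apply/eqP; rewrite eq_le le0 sqr_ge0.
Qed.
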